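(* Let $S(t)$ be a strongly continuous semigroup on a complex Hilbert space with generator $A$, and let $m:[0,+\infty[\to]0,+\infty[$ be continuous with piecewise continuous derivative, with $m(0)=1$, $\|S(t)\|\le m(t)$ for all $t\ge0$, and $\mathfrak S$-invariant, i.e. $\mathfrak S(m)=m$. Let $\omega_0\in\mathbb R$ be such that $r(\omega_0)>0$. Then $$(\mathfrak S U_{\omega_0})^2 m=\mathfrak S U_{\omega_0}m,$$ and consequently the iteration $m\mapsto(\mathfrak S U_{\omega_0})^k m$, $k=1,2,\dots$, becomes stationary after the first step: $$(\mathfrak S U_{\omega_0})^k m=\mathfrak S U_{\omega_0} m\qquad\text{for all } k\ge1 .$$
   Context: For $\omega\in\mathbb R$, $r(\omega)=\left(\sup_{\operatorname{Re}z>\omega}\|(z-A)^{-1}\|\right)^{-1}$, with $\|(z-A)^{-1}\|=+\infty$ if $z\in\operatorname{Spec}A$ and $1/(+\infty)=0$. Definition of $\mathfrak S$: for a function $m$ with values in $[0,+\infty[$ and $m(0)=1$, put $$\mathfrak S(m)(t)=\lim_{N\to\infty}\ \inf_{t_1,\dots,t_N\ge0,\ t_1+\dots+t_N=t} m(t_1)m(t_2)\cdots m(t_N),\qquad t\ge0$$ (the sequence is decreasing in $N$ since $m(0)=1$). Definition of $a^*$: for $\omega\in\mathbb R$, $r>0$ and a positive function $m$, let $\phi$ be the maximal solution of $$\phi'(t)=r\left(\phi(t)^2+2\mu(t)\phi(t)+1\right),\quad \phi(0)=0,\qquad \mu(t)=\frac1r\left(\frac{m'(t)}{m(t)}-\omega\right),$$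 and $a^*(m,\omega,r)=\inf\{t\ge0: \phi(t)=1\}\in]0,+\infty]$ ($+\infty$ if $\phi$ never equals $1$). The value $a^*(m,\omega,r)$, when finite, depends only on the restriction of $m$ to $[0,a^*]$, so it is defined as soon as $m$ is continuous with piecewise continuous derivative on an interval $[0,T]$ within which $\phi$ reaches $1$. Definition of $U_\omega$: with $r=r(\omega)>0$ and $a^*=a^*(m,\omega,r(\omega))$, $$U_\omega(m)(t)=\begin{cases} m(t),&0\le t\le 2a^*,\\ \min\{m(t),\,e^{(\omega-r(\omega))(t-2a^* )}m(a^* )^2\},&t>2a^*,\end{cases}$$ and $U_\omega(m)=m$ if $a^*=+\infty$. *)

(* Defs.v *)
From HB Require Import structures.
From mathcomp Require Import all_boot all_order all_algebra.
From mathcomp Require Import all_classical all_reals all_analysis.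
From mathcomp Require Import complex.

Set Implicit Arguments.
Unset Strict Implicit.
Unset Printing Implicit Defensive.

Import Order.TTheory GRing.Theory Num.Theory.
Import numFieldNormedType.Exports.

Local Open Scope classical_set_scope.
Local Open Scope ring_scope.
Local Open Scope complex_scope.

Section Operators.
Context {R : realType} {H : completeNormedModType R[i]}.

(* The norm of [H] takes its values in [R[i]]; they are real and nonnegative,
   so that [complex.Re] loses nothing. *)
Definition op_norm (T : H -> H) : \bar R :=
  ereal_sup [set (complex.Re `|T x|)%:E | x in [set x | `|x| <= 1]].

(* An operator on [H] with domain [dom]; [app] is junk outside of [dom]. *)
Record unbounded_op := UnboundedOp { dom : set H ; app : H -> H }.

Definition is_resolvent (A : unbounded_op) (z : R[i]) (T : H -> H) : Prop :=
  [/\ linear T, continuous T,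
      forall x, dom A x -> T (z *: x - app A x) = x &
      forall y, dom A (T y) /\ z *: T y - app A (T y) = y].

Definition resolvent_set (A : unbounded_op) : set R[i] :=
  [set z | exists T, is_resolvent A z T].

Definition spectrum (A : unbounded_op) : set R[i] := ~` resolvent_set A.

Definition resolvent (A : unbounded_op) (z : R[i]) : H -> H :=
  get (is_resolvent A z).

Definition resolvent_norm (A : unbounded_op) (z : R[i]) : \bar R :=
  if `[< spectrum A z >] then +oo%E else op_norm (resolvent A z).

(* The inverse in [\bar R] satisfies [+oo^-1 = 0] and [0^-1 = +oo].  The
   supremum vanishes only if [H] is the zero space, and then [fine +oo = 0], so
   the condition [0 < resolvent_radius A w] excludes that degenerate case. *)
Definition resolvent_radius (A : unbounded_op) (w : R) : R :=
  let M : \bar R := ereal_sup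
    [set resolvent_norm A z | z in [set z : R[i] | w < complex.Re z]] in
  fine (M^-1)%E.

Definition is_C0_semigroup (S : R -> H -> H) : Prop :=
  [/\ forall t : R, 0 <= t -> linear (S t) /\ continuous (S t),
      forall x, S 0 x = x,
      forall (s t : R) x, 0 <= s -> 0 <= t -> S (s + t) x = S s (S t x) &
      forall x, S t x @[t --> 0^'+] --> x].

Definition diff_quotient (S : R -> H -> H) (x : H) (t : R) : H :=
  (t^-1)%:C *: (S t x - x).

Definition generator (S : R -> H -> H) : unbounded_op := UnboundedOp
  [set x | cvg (diff_quotient S x t @[t --> 0^'+])]
  (fun x => lim (diff_quotient S x t @[t --> 0^'+])).

End Operators.

Arguments unbounded_op {R} H.

(* Functions on [[0, +oo[] are represented by functions on [R], whose values at
   negative arguments are irrelevant. *)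
Section Bounds.
Context {R : realType}.

Definition frakS (m : R -> R) (t : R) : R :=
  lim (inf [set \prod_(i < N) m (s i) |
              s in [set s : 'I_N -> R | (forall i, 0 <= s i) /\
                                        \sum_(i < N) s i = t]] @[N --> \oo]).

(* [m] is continuous on [[0, T]] and its derivative is continuous there outside
   of a finite set, with finite one-sided limits everywhere. *)
Definition piecewise_C1 (m : R -> R) (T : R) : Prop :=
  {within `[0, T], continuous m} /\
  exists s : seq R,
    [/\ forall t : R, 0 < t < T -> t \notin s ->
          derivable m t 1 /\ {for t, continuous (derive1 m)},
        forall t : R, 0 <= t < T -> cvg (derive1 m x @[x --> t^'+]) &
        forall t : R, 0 < t <= T -> cvg (derive1 m x @[x --> t^'-])].

Definition mu (m : R -> R) (w r t : R) : R := r^-1 * (derive1 m t / m t - w).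

(* [phi] solves the initial value problem on [J], an interval of the form
   [[0, T]], [[0, T[] or [[0, +oo[] on which [m] is continuous with piecewise
   continuous derivative.  Since [m'] may jump, the equation is required outside
   of a finite subset of each compact subinterval, [phi] being continuous. *)
Definition ode_solution (m : R -> R) (w r : R) (J : set R) (phi : R -> R)
    : Prop :=
  [/\ is_interval J, J 0 & J `<=` [set t | 0 <= t]] /\
  [/\ forall T : R, J T -> piecewise_C1 m T,
      {within J, continuous phi}, phi 0 = 0 &
      forall T : R, J T -> exists s : seq R,
        forall t : R, 0 < t < T -> t \notin s ->
          is_derive t 1 phi (r * (phi t ^+ 2 + 2 * mu m w r t * phi t + 1))].

Definition maximal_ode_solution (m : R -> R) (w r : R) (J : set R)
    (phi : R -> R) : Prop :=
  ode_solution m w r J phi /\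
  forall (J' : set R) (phi' : R -> R), ode_solution m w r J' phi' ->
    J `<=` J' -> {in J, phi' =1 phi} -> J' = J.

(* The maximal solution is unique (up to the values of [phi] outside of [J]);
   the infimum of the empty set is [+oo]. *)
Definition a_star (m : R -> R) (w r : R) : \bar R :=
  ereal_inf [set t%:E | t in [set t | exists (J : set R) (phi : R -> R),
    [/\ maximal_ode_solution m w r J phi, J t & phi t = 1]]].

Definition U_op (w r : R) (m : R -> R) (t : R) : R :=
  if a_star m w r is a%:E then
    if t <= 2 * a then m t
    else Num.min (m t) (expR ((w - r) * (t - 2 * a)) * m a ^+ 2)
  else m t.

End Bounds.

Definition U_omega {R : realType} {H : completeNormedModType R[i]}
    (A : unbounded_op H) (w : R) : (R -> R) -> (R -> R) :=
  U_op w (resolvent_radius A w).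

(* Main.v *)
Require Import Defs.
From HB Require Import structures.
From mathcomp Require Import all_boot all_order all_algebra.
From mathcomp Require Import all_classical all_reals all_analysis.
From mathcomp Require Import complex.
From mathcomp Require Import ring lra.

Set Implicit Arguments.
Unset Strict Implicit.
Unset Printing Implicit Defensive.

Import Order.TTheory GRing.Theory Num.Theory.
Import numFieldNormedType.Exports.

Local Open Scope classical_set_scope.
Local Open Scope ring_scope.

(** The proof is purely about functions on the half-line.  Write [u] for
    [U_op w r m], where [w] is [omega0] and [r] its resolvent radius, write [a]
    for [a_star m w r], and let [n = frakS u] be the first iterate.

    Suppose first that [a] is finite.  The function [u] coincides with [m] on
    [[0, 2a]], and [frakS u t] looks at [u] on [[0, t]] only, so
    [n = frakS m = m] on [[0, 2a]].  The number [a] is determined by the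
    function near [[0, a]], which lies well inside [[0, 2a]] because [a > 0];
    hence [a_star n w r = a].  Therefore [U_op w r n] takes the minimum of [n]
    with the same exponential bound [exp((w - r)(t - 2a)) m(a)^2] as
    [U_op w r m] does, and [n <= u] is already below that bound: the operator
    does not change [n].  Finally [frakS n = n], since [frakS] is idempotent,
    so [n] is a fixed point of the iteration.  If [a] is infinite, then [u = m]
    and [n = frakS m = m].

    Three facts carry this.  [frakS_idem]: the values of [frakS] are
    submultiplicative, and a submultiplicative function is not lowered by
    splitting the time.  [a_star_eq_itv]: locality of [a_star].  As [a_star]
    speaks of maximal solutions, and the two functions may have different
    maximal solutions beyond the interval where they agree, a solution for one
    of them is cut down to that interval and extended again to a maximal one
    for the other, by Zorn's lemma ([maximal_ode_solution_exists]); uniqueness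
    of solutions is thus avoided.  [reaches_one_bounded_below]: [a > 0],
    because the arctangent of a solution has a bounded derivative near 0. *)

(** * The operator [frakS] *)

Section FrakS.
Context {R : realType}.
Implicit Types (u f g : R -> R) (s t L : R) (p q : seq R).

(** The set whose infimum is the [N]-th term of the sequence defining
    [frakS u t]. *)
Definition products u (N : nat) t : set R :=
  [set \prod_(i < N) u (x i) |
    x in [set x : 'I_N -> R | (forall i, 0 <= x i) /\ \sum_(i < N) x i = t]].

Definition nonneg_seq p := {in p, forall x, 0 <= x}.

(** Splittings of [t] are handled as sequences from here on, because they can
    be concatenated without any reindexing. *)
Lemma products_seq u p :
  nonneg_seq p -> products u (size p) (\sum_(x <- p) x) (\prod_(x <- p) u x).
Proof.
move=> p0; exists (fun i => p`_i); last by rewrite [RHS](big_nth 0) big_mkord.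
by split=> [i|]; [apply/p0/mem_nth | rewrite [RHS](big_nth 0) big_mkord].
Qed.

Lemma productsP u N t y : products u N t y -> exists p : seq R,
  [/\ nonneg_seq p, \sum_(x <- p) x = t & \prod_(x <- p) u x = y].
Proof.
move=> [x [x0 xt] <-]; exists [seq x i | i <- index_enum 'I_N].
by split; rewrite ?big_map// => _ /mapP[i _ ->].
Qed.

Lemma frakS_eq f g t :
  {in `[0, t], f =1 g} -> frakS f t = frakS g t.
Proof.
move=> fg; congr (lim (_ @ \oo)); apply/funext => N; congr inf.
apply: eq_imagel => x [x0 xt]; apply: eq_bigr => i _; apply: fg.
by rewrite in_itv/= x0 -xt (bigD1 i)//= lerDl sumr_ge0.
Qed.

(** The value 1 at 0 makes a product unchanged when a step of length 0 is
    inserted into the splitting. *)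
Definition unit_bound u := (forall t, 0 <= t -> 0 <= u t) /\ u 0 = 1.

Lemma prod_ge0 u p : unit_bound u -> nonneg_seq p -> 0 <= \prod_(x <- p) u x.
Proof.
by move=> [u0 _] p0; rewrite big_seq prodr_ge0// => x /p0; exact: u0.
Qed.

Lemma products_lbound0 u N t : unit_bound u -> lbound (products u N t) 0.
Proof. by move=> hu _ /productsP[p [p0 _ <-]]; exact: prod_ge0. Qed.

Lemma products_nonempty u N t : 0 <= t -> products u N.+1 t !=set0.
Proof.
move=> t0; exists (\prod_(i < N.+1) u (if i == ord0 then t else 0)).
exists (fun i => if i == ord0 then t else 0) => //.
split=> [i|]; first by case: ifP.
by rewrite big_ord_recl/= big1 ?addr0.
Qed.

Lemma products_incr u N t :
  unit_bound u -> products u N t `<=` products u N.+1 t.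
Proof.
move=> [_ u0] _ [x [x0 xt] <-].
exists (fun i => if unlift ord0 i is Some j then x j else 0).
  split=> [i|]; first by case: unlift.
  rewrite big_ord_recl unlift_none add0r -xt.
  by apply: eq_bigr => i _; rewrite liftK.
rewrite big_ord_recl unlift_none u0 mul1r.
by apply: eq_bigr => i _; rewrite liftK.
Qed.

(** The infima decrease because a step of length 0 can be inserted.  The index
    is shifted since [products u 0 t] is empty for [t <> 0], and the infimum of
    the empty set is the junk value 0. *)
Lemma frakS_lim u t : unit_bound u -> 0 <= t ->
  [/\ nonincreasing_seq (fun N => inf (products u N.+1 t)),
      cvgn (fun N => inf (products u N.+1 t)) &
      frakS u t = limn (fun N => inf (products u N.+1 t))].
Proof.
move=> hu t0; set I := fun N => _.
have lb N : has_lbound (products u N t).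
  by exists 0; exact: products_lbound0.
have I_decr : nonincreasing_seq I.
  apply/nonincreasing_seqP => N; apply: lb_le_inf.
    exact: products_nonempty.
  by move=> y /(products_incr hu); exact: ge_inf.
have I_cvg : cvgn I.
  apply: nonincreasing_is_cvgn => //; exists 0 => _ [N _ <-].
  by apply: lb_le_inf; [exact: products_nonempty | exact: products_lbound0].
split=> //; apply: cvg_lim => //.
by rewrite -(cvg_shiftS (fun N => inf (products u N t))).
Qed.

(** With [frakS_greatest] below, this says that [frakS u t] is the infimum of
    the products over all finite splittings of [t]; everything about [frakS]
    is deduced from these two properties. *)
Lemma frakS_le_prod u p : unit_bound u -> nonneg_seq p ->
  frakS u (\sum_(x <- p) x) <= \prod_(x <- p) u x.
Proof.
move=> hu p0; set t := \sum_(x <- p) x.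
have t0 : 0 <= t by rewrite /t big_seq sumr_ge0.
have [I_decr I_cvg ->] := frakS_lim hu t0.
apply: (le_trans (nonincreasing_cvgn_ge I_decr I_cvg (size p))).
apply: ge_inf; first by exists 0; exact: products_lbound0.
by apply: products_incr => //; exact: products_seq.
Qed.

Lemma frakS_greatest u t L : unit_bound u -> 0 <= t ->
  (forall p, nonneg_seq p -> \sum_(x <- p) x = t -> L <= \prod_(x <- p) u x) ->
  L <= frakS u t.
Proof.
move=> hu t0 hL; have [_ I_cvg ->] := frakS_lim hu t0.
apply: limr_ge => //; near=> N; apply: lb_le_inf.
  exact: products_nonempty.
by move=> _ /productsP[p [p0 pt <-]]; exact: hL.
Unshelve. all: by end_near. Qed.

Lemma frakS_le u t : unit_bound u -> 0 <= t -> frakS u t <= u t.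
Proof.
move=> hu t0; have p0 : nonneg_seq [:: t] by move=> x; rewrite inE => /eqP->.
by have := frakS_le_prod hu p0; rewrite !big_seq1.
Qed.

Lemma frakS_ge0 u t : unit_bound u -> 0 <= t -> 0 <= frakS u t.
Proof.
by move=> hu t0; apply: frakS_greatest => // p p0 _; exact: prod_ge0.
Qed.

Lemma frakS_unit_bound u : unit_bound u -> unit_bound (frakS u).
Proof.
move=> hu; split=> [t|]; first exact: frakS_ge0.
apply/eqP; rewrite eq_le; have := frakS_le hu (lexx 0); rewrite hu.2 => ->/=.
apply: frakS_greatest => // p p0 /eqP.
rewrite big_seq psumr_eq0// => /allP p_eq0.
rewrite big_seq big1// => x xp.
by have /implyP/(_ xp)/eqP-> := p_eq0 _ xp; rewrite hu.2.
Qed.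

(** The infimum commutes with multiplication by [c >= 0]; for [c = 0] this
    takes a splitting to exist, whence [0 <= t]. *)
Lemma le_mulr_frakS u t c L : unit_bound u -> 0 <= t -> 0 <= c ->
  (forall p, nonneg_seq p -> \sum_(x <- p) x = t ->
    L <= c * \prod_(x <- p) u x) ->
  L <= c * frakS u t.
Proof.
move=> hu t0; rewrite le_eqVlt => /predU1P[<-|c0] hL.
  rewrite mul0r -[leRHS](mul0r (\prod_(x <- [:: t]) u x)).
  by apply: hL; [move=> x; rewrite inE => /eqP-> | rewrite big_seq1].
rewrite mulrC -ler_pdivrMr//; apply: frakS_greatest => // p p0 pt.
by rewrite ler_pdivrMr// mulrC hL.
Qed.

(** Splittings of [s] and of [t] concatenate to splittings of [s + t]. *)
Lemma frakS_submultiplicative u s t : unit_bound u -> 0 <= s -> 0 <= t ->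
  frakS u (s + t) <= frakS u s * frakS u t.
Proof.
move=> hu s0 t0; apply: le_mulr_frakS => //; first exact: frakS_ge0.
move=> q q0 <-; rewrite mulrC; apply: le_mulr_frakS => //.
  exact: prod_ge0.
move=> p p0 <-; rewrite mulrC -!big_cat; apply: frakS_le_prod => // x.
by rewrite mem_cat => /orP[/p0|/q0].
Qed.

(** By submultiplicativity, the product of [frakS u] over any splitting of [t]
    is at least [frakS u t]. *)
Lemma frakS_idem u t : unit_bound u -> 0 <= t ->
  frakS (frakS u) t = frakS u t.
Proof.
move=> hu t0; have hS := frakS_unit_bound hu.
apply/eqP; rewrite eq_le frakS_le//=; apply: frakS_greatest => // p p0 <-.
elim: p p0 {t t0} => [|x p IHp] p0; first by rewrite !big_nil hS.2.
have x0 : 0 <= x by rewrite p0 ?mem_head.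
have {}p0 : nonneg_seq p by move=> y yp; rewrite p0// inE yp orbT.
rewrite !big_cons.
apply: (le_trans (frakS_submultiplicative hu x0 _)).
  by rewrite big_seq sumr_ge0.
by rewrite ler_wpM2l ?IHp// frakS_ge0.
Qed.

End FrakS.

(** * Restriction and extension of solutions *)

Section Ode.
Context {R : realType} (w r : R).
Implicit Types (f g phi psi : R -> R) (s t T : R) (J : set R).

Lemma near_itvoo_eq f g T t : {in `[0, T], f =1 g} -> 0 < t < T ->
  \forall x \near t, f x = g x.
Proof.
move=> fg t0T; near=> x; apply: fg; apply: subset_itv_oo_cc.
by near: x; apply: near_in_itvoo; rewrite in_itv.
Unshelve. all: by end_near. Qed.

Lemma derive1_itvoo_eq f g T :
  {in `[0, T], f =1 g} -> {in `]0, T[, derive1 f =1 derive1 g}.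
Proof.
move=> fg t; rewrite in_itv/= => t0T; rewrite !derive1E.
exact/near_eq_derive/(near_itvoo_eq fg).
Qed.

Lemma piecewise_C1_eq f g T :
  {in `[0, T], f =1 g} -> piecewise_C1 f T -> piecewise_C1 g T.
Proof.
move=> fg [f_cont [s [f_deriv f_right f_left]]].
have dfg := derive1_itvoo_eq fg.
split.
  by apply: subspace_eq_continuous f_cont => x; rewrite inE; apply: fg.
exists s; split=> [t t0T ts|t /andP[t0 tT]|t /andP[t0 tT]].
- have [df df_cont] := f_deriv t t0T ts; split.
    by apply: near_eq_derivable df; exact: near_itvoo_eq t0T.
  have dfgt : derive1 g t = derive1 f t by rewrite dfg// in_itv.
  rewrite /prop_for /continuous_at dfgt; apply: cvg_trans df_cont.
  apply: near_eq_cvg; near=> x; apply: dfg.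
  by near: x; apply: near_in_itvoo; rewrite in_itv.
- have := f_right t; rewrite t0 tT => /(_ isT)/cvg_ex[l fl].
  apply/cvg_ex; exists l; apply: cvg_trans fl; apply: near_eq_cvg.
  near=> x; apply: dfg; rewrite in_itv/=; apply/andP; split.
    by apply: (le_lt_trans t0); near: x; exact: nbhs_right_gt.
  by near: x; exact: nbhs_right_lt.
- have := f_left t; rewrite t0 tT => /(_ isT)/cvg_ex[l fl].
  apply/cvg_ex; exists l; apply: cvg_trans fl; apply: near_eq_cvg.
  near=> x; apply: dfg; rewrite in_itv/=; apply/andP; split.
    by near: x; exact: nbhs_left_gt.
  by apply: lt_le_trans tT; near: x; exact: nbhs_left_lt.
Unshelve. all: by end_near. Qed.

Lemma ode_solution_ge0 f J phi t : ode_solution f w r J phi -> J t -> 0 <= t.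
Proof. by move=> [[_ _ Jge0] _]; exact: Jge0. Qed.

Lemma ode_solution_itv f J phi T t : ode_solution f w r J phi ->
  J T -> 0 <= t <= T -> J t.
Proof. by move=> [[Jitv J0 _] _] JT; exact: Jitv JT _. Qed.

(** The transfer from [f] to [g]: nothing in the definition of a solution on
    [[0, T]] depends on the function outside of that interval, as derivatives
    are taken at interior points and limits from inside. *)
Lemma ode_solution_restrict f g J phi T : {in `[0, T], f =1 g} -> J T ->
  ode_solution f w r J phi -> ode_solution g w r `[0, T] phi.
Proof.
move=> fg JT sol; have [[Jitv J0 Jge0] [f_C1 phi_cont phi0 phi_ode]] := sol.
have T0 := Jge0 _ JT.
have sub t : 0 <= t <= T -> J t by exact: ode_solution_itv sol JT.
split; split=> //.
- exact: interval_is_interval.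
- by rewrite /= in_itv/= lexx.
- by move=> t /=; rewrite in_itv/= => /andP[].
- move=> t /=; rewrite in_itv/= => t0T.
  apply: piecewise_C1_eq (f_C1 _ (sub _ t0T)).
  move=> x; rewrite in_itv/= => /andP[x0 xt]; apply: fg.
  by case/andP: t0T => t0 tT; rewrite in_itv/= x0 (le_trans xt tT).
- apply: continuous_subspaceW phi_cont => t /=; rewrite in_itv/=; exact: sub.
- move=> t /=; rewrite in_itv/= => /andP[t0 tT].
  have [s hs] := phi_ode _ (sub _ (introT andP (conj t0 tT))).
  exists s => x /andP[x0 xt] xs.
  have xT := lt_le_trans xt tT.
  have fgx : f x = g x by apply: fg; rewrite in_itv/= !ltW.
  rewrite /mu -fgx -(derive1_itvoo_eq fg) ?in_itv/= ?x0//.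
  by apply: hs => //; rewrite x0.
Qed.

(** The upper bounds needed for Zorn's lemma.  The conditions on [J] and [phi]
    are local, so they pass to the union of a chain. *)
Lemma ode_solution_chain f (F : set (set R * (R -> R))) P0 :
  F P0 -> (forall P, F P -> ode_solution f w r P.1 P.2) ->
  (forall P Q, F P -> F Q ->
    (P.1 `<=` Q.1 /\ {in P.1, Q.2 =1 P.2}) \/
    (Q.1 `<=` P.1 /\ {in Q.1, P.2 =1 Q.2})) ->
  exists phi, ode_solution f w r (\bigcup_(P in F) P.1) phi /\
    forall P, F P -> {in P.1, phi =1 P.2}.
Proof.
move=> FP0 Fsol Fchain.
have agree P Q t : F P -> F Q -> P.1 t -> Q.1 t -> P.2 t = Q.2 t.
  by move=> FP FQ Pt Qt; case: (Fchain _ _ FP FQ) => -[_ ->]//; rewrite inE.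
pose phi t := (get [set P | F P /\ P.1 t]).2 t.
have phiE P t : F P -> P.1 t -> phi t = P.2 t.
  move=> FP Pt.
  have [FQ Qt] : [set Q | F Q /\ Q.1 t] (get [set Q | F Q /\ Q.1 t]).
    by apply: getPex; exists P.
  exact: agree.
exists phi; split; last by move=> P FP t; rewrite inE; exact: phiE.
split; split.
- move=> x y [P FP Px] [Q FQ Qy] z /andP[xz zy].
  exists Q => //; apply: (ode_solution_itv (Fsol _ FQ) Qy).
  by rewrite zy (le_trans (ode_solution_ge0 (Fsol _ FP) Px) xz).
- by exists P0 => //; have [[]] := Fsol _ FP0.
- by move=> t [P FP]; exact: ode_solution_ge0 (Fsol _ FP).
- by move=> T [P FP PT]; have [_ [f_C1 _ _ _]] := Fsol _ FP; exact: f_C1.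
- apply/subspace_continuousP => t [P FP Pt].
  (* Some domain in the chain is a relative neighbourhood of [t] in the union:
     one that reaches beyond [t] if there is any, and else [P.1] itself, which
     is then the whole union. *)
  have [Q [FQ Qt [b tb Qb]]] : exists Q, [/\ F Q, Q.1 t &
      exists2 b, t < b & forall x, x < b -> (\bigcup_(P in F) P.1) x -> Q.1 x].
    have [[Q [FQ [b Qb tb]]]|noQ] :=
        pselect (exists Q, F Q /\ exists2 b, Q.1 b & t < b).
      exists Q; split=> //.
        apply: (ode_solution_itv (Fsol _ FQ) Qb).
        by rewrite (ode_solution_ge0 (Fsol _ FP) Pt) ltW.
      exists b => // x xb [P' FP' P'x].
      apply: (ode_solution_itv (Fsol _ FQ) Qb).
      by rewrite (ltW xb) (ode_solution_ge0 (Fsol _ FP') P'x).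
    exists P; split=> //; exists (t + 1); first by rewrite ltrDl.
    move=> x _ [P' FP' P'x]; apply: (ode_solution_itv (Fsol _ FP) Pt).
    rewrite (ode_solution_ge0 (Fsol _ FP') P'x)/= leNgt.
    by apply/negP => tx; apply: noQ; exists P'; split=> //; exists x.
  have [_ [_ /subspace_continuousP/(_ _ Qt) Qcont _ _]] := Fsol _ FQ.
  have phit : phi t = Q.2 t by exact: phiE.
  move=> V; rewrite /from_subspace phit => /Qcont QV.
  have {}QV : \forall x \near t, Q.1 x -> V (Q.2 x) by exact: QV.
  suff : \forall x \near t, (\bigcup_(P in F) P.1) x -> V (phi x) by [].
  near=> x => Ux.
  have Qx : Q.1 x.
    by apply: Qb => //; near: x; exact: lt_nbhsl.
  by rewrite (phiE Q)//; move: Qx; near: x.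
- by have [[_ Q0 _] [_ _ phi0 _]] := Fsol _ FP0; rewrite (phiE P0).
- move=> T [P FP PT]; have [_ [_ _ _ /(_ _ PT)[s hs]]] := Fsol _ FP.
  exists s => t t0T ts; have PtT x : 0 <= x <= T -> P.1 x.
    exact: ode_solution_itv (Fsol _ FP) PT.
  have phit : phi t = P.2 t.
    by apply: phiE => //; apply: PtT; case/andP: t0T => t0 tT; rewrite !ltW.
  rewrite phit; apply: near_eq_is_derive (hs _ t0T ts).
  apply: (near_itvoo_eq (T := T)) t0T => x; rewrite in_itv/= => x0T.
  by rewrite (phiE P) //; exact: PtT.
Unshelve. all: by end_near. Qed.

Lemma maximal_ode_solution_exists f J phi : ode_solution f w r J phi ->
  exists (J' : set R) (phi' : R -> R), [/\ maximal_ode_solution f w r J' phi',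
    J `<=` J' & {in J, phi' =1 phi}].
Proof.
move=> sol.
pose le (P Q : set R * (R -> R)) := P.1 `<=` Q.1 /\ {in P.1, Q.2 =1 P.2}.
have le_refl P : le P P by split.
have le_trans P Q S : le P Q -> le Q S -> le P S.
  move=> [PQ ePQ] [QS eQS]; split; first exact: subset_trans QS.
  by move=> t tP; rewrite eQS ?ePQ// inE; apply: PQ; move: tP; rewrite inE.
pose ext : Type := {P | ode_solution f w r P.1 P.2 /\ le (J, phi) P}.
pose base : ext := exist _ (J, phi) (conj sol (le_refl _)).
have [||A Achain|[[J' phi'] [sol' ext']] /= maxP] := @ZL_preorder ext base
    (fun P Q => `[< le (sval P) (sval Q) >]).
- by move=> P; exact/asboolP.
- by move=> P Q S /asboolP PQ /asboolP QS; apply/asboolP; exact: le_trans QS.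
- have [[P0 AP0]|A0] := pselect (exists P, A P); last first.
    by exists base => P AP; exfalso; apply: A0; exists P.
  pose F := [set sval P | P in A].
  have [|||psi [psi_sol psiE]] := @ode_solution_chain f F (sval P0).
  + by exists P0.
  + by move=> _ [P AP <-]; exact: (svalP P).1.
  + move=> _ _ [P AP <-] [Q AQ <-].
    by case: (Achain P Q AP AQ) => /asboolP; [left|right].
  pose U := \bigcup_(P in F) P.1.
  have leU P : A P -> le (sval P) (U, psi).
    move=> AP; split=> [t Pt|]; first by exists (sval P) => //; exists P.
    by apply: psiE; exists P.
  have extU : le (J, phi) (U, psi) := le_trans _ _ _ (svalP P0).2 (leU _ AP0).
  exists (exist _ (U, psi) (conj psi_sol extU)).
  by move=> P AP; apply/asboolP; exact: leU.
have [JJ' phiE] := ext'.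
exists J', phi'; split=> //; split=> // J2 phi2 sol2 sub2 eq2.
have ext2 : le (J, phi) (J2, phi2) by apply: (le_trans _ _ _ ext').
have /asboolP[/= J2J' _] := maxP (exist _ (J2, phi2) (conj sol2 ext2))
  (asboolT (conj sub2 eq2)).
exact/seteqP.
Qed.

(** The set of times whose infimum is [a_star f w r]. *)
Definition reaches_one f : set R := [set t | exists J phi,
  [/\ maximal_ode_solution f w r J phi, J t & phi t = 1]].

(** The solution for [f] is cut down to [[0, t]] and extended again to a maximal
    solution for [g], which may differ from the one for [f] after [t]. *)
Lemma reaches_one_eq f g t :
  {in `[0, t], f =1 g} -> reaches_one f t -> reaches_one g t.
Proof.
move=> fg [J [phi [[sol _] Jt phit]]].
have [_ _ Jge0] := sol.1.
have tt : t \in `[0, t] by rewrite in_itv/= lexx andbT Jge0.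
have [J' [phi' [maxJ' sub eq]]] :=
  maximal_ode_solution_exists (ode_solution_restrict fg Jt sol).
by exists J', phi'; split; [|exact: sub|rewrite eq ?inE].
Qed.

End Ode.

(** * Solutions do not reach 1 immediately *)

Section FirstHit.
Context {R : realType}.
Implicit Types (f m phi : R -> R) (t C : R).

(** A mean value inequality with a finite exceptional set [s], proved by cutting
    the interval at the exceptional points. *)
Lemma increment_le f (s : seq R) (a b C : R) : a <= b ->
  {within `[a, b], continuous f} ->
  (forall t, a < t < b -> t \notin s -> derivable f t 1 /\ derive1 f t <= C) ->
  f b - f a <= C * (b - a).
Proof.
elim: s a b => [|c s IHs] a b ab f_cont f_deriv.
  move: ab; rewrite le_eqVlt => /predU1P[<-|ab]; first by rewrite !subrr mulr0.
  have [t tab|t tab ->] := MVT (df := derive1 f) ab _ f_cont.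
    have [/derivableP df _] := f_deriv t tab isT.
    by rewrite derive1E.
  by rewrite ler_wpM2r ?subr_ge0 ?(ltW ab)//; exact: (f_deriv t tab isT).2.
have [acb|acb] := boolP (a < c < b); last first.
  apply: IHs => // t tab ts; apply: f_deriv => //.
  by rewrite inE negb_or ts andbT; apply: contraNneq acb => <-.
have /andP[ac cb] := acb.
have -> : f b - f a = (f c - f a) + (f b - f c) by ring.
have -> : C * (b - a) = C * (c - a) + C * (b - c) by ring.
apply: lerD; apply: IHs; rewrite ?ltW//.
- apply: continuous_subspaceW f_cont => t /=; rewrite !in_itv/= => /andP[-> tc].
  by rewrite (le_trans tc)// ltW.
- move=> t /andP[ta tc] ts; apply: f_deriv; rewrite ?ta ?(lt_trans tc)//.
  by rewrite inE negb_or ts andbT lt_eqF.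
- apply: continuous_subspaceW f_cont => t /=; rewrite !in_itv/= => /andP[ct ->].
  by rewrite (le_trans _ ct)// ltW.
- move=> t /andP[ct tb] ts; apply: f_deriv; rewrite ?tb ?(lt_trans ac)//.
  by rewrite inE negb_or ts andbT gt_eqF.
Qed.

(** [m'] has a finite limit from the right at 0 and [m] is close to [m 0 > 0]
    there. *)
Lemma mu_bounded_near0 m w r T : 0 < T -> piecewise_C1 m T -> 0 < m 0 ->
  exists2 e, 0 < e & exists M, forall t, 0 < t < e -> `|mu m w r t| <= M.
Proof.
move=> T0 [m_cont [s [_ m_right _]]] m0.
have [_ m_cvg0 _] := (continuous_within_itvP m T0).1 m_cont.
have /cvg_ex[l m'_cvg] : cvg (derive1 m x @[x --> 0^'+]).
  by apply: m_right; rewrite lexx.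
have [e /= e0 he] : \forall x \near (0 : R)^'+,
    `|derive1 m x| < `|l| + 1 /\ m 0 / 2 < m x.
  near=> x; split; near: x.
    by apply: (cvgr_norm_lt _ m'_cvg); rewrite ltrDl.
  by apply: (cvgr_gt _ m_cvg0); rewrite ltr_pdivrMr// mulr_natr mulr2n ltrDl.
exists e => //; exists (`|r^-1| * ((`|l| + 1) / (m 0 / 2) + `|w|)).
move=> t /andP[t0 te].
have [dm mt] : `|derive1 m t| < `|l| + 1 /\ m 0 / 2 < m t.
  by apply: he => //=; rewrite sub0r normrN gtr0_norm.
rewrite /mu normrM ler_wpM2l// (le_trans (ler_normB _ _))// lerD2r normf_div.
have m02 : 0 < m 0 / 2 by rewrite divr_gt0.
have mt0 : 0 < m t by exact: lt_trans mt.
rewrite (gtr0_norm mt0) ler_pM ?invr_ge0 ?(ltW dm) ?(ltW mt0)//.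
by rewrite lef_pV2 ?posrE// ltW.
Unshelve. all: by end_near. Qed.

(** If [|mu| <= M] on []0, e[], then [atan phi] satisfies there
    [(atan phi)' = r (1 + 2 mu phi / (1 + phi^2)) <= |r| (1 + M)], whatever the
    size of [phi], while it has to grow from 0 to [atan 1]. *)
Lemma reaches_one_bounded_below m w r T :
  0 < T -> piecewise_C1 m T -> 0 < m 0 ->
  exists2 d, 0 < d & forall t, reaches_one w r m t -> d <= t.
Proof.
move=> T0 m_C1 m0; have [e e0 [M hM]] := mu_bounded_near0 w r T0 m_C1 m0.
have M0 : 0 <= M.
  apply: le_trans (hM (e / 2) _) => //.
  by rewrite divr_gt0//= ltr_pdivrMr// mulr_natr mulr2n ltrDl.
(* The added 1 keeps [C] positive when [r = 0]. *)
pose C := `|r| * (1 + M) + 1.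
have C0 : 0 < C by rewrite ltr_wpDl// mulr_ge0// addr_ge0.
have atan1_gt0 : 0 < atan 1 :> R by rewrite atan1 divr_gt0 ?pi_gt0.
exists (Num.min e (atan 1 / C)); first by rewrite lt_min e0 divr_gt0.
move=> t [J [phi [[sol _] Jt phit]]]; rewrite ge_min.
have [//|te] := leP e t; rewrite /= ler_pdivrMr// mulrC.
have [_ [_ phi_cont phi0 /(_ _ Jt)[s hs]]] := sol.
have t0 := ode_solution_ge0 sol Jt.
have := @increment_le (atan \o phi) s 0 t C t0.
rewrite /= phit phi0 atan0 !subr0; apply.
  apply/subspace_continuousP => x; rewrite /= in_itv/= => x0t.
  apply: continuous_cvg; first exact: continuous_atan.
  have Jx := ode_solution_itv sol Jt x0t.
  move/subspace_continuousP : phi_cont => /(_ x Jx); apply: cvg_trans.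
  apply: cvg_app; apply: within_subset => y /=; rewrite in_itv/=.
  exact: ode_solution_itv sol Jt.
move=> x /andP[x0 xt] xs.
have phi_deriv :
    is_derive x 1 phi (r * (phi x ^+ 2 + 2 * mu m w r x * phi x + 1)).
  by apply: hs => //; rewrite x0.
have phi_atan := is_derive1_comp (is_derive1_atan (phi x)) phi_deriv.
split; first exact: ex_derive.
rewrite derive1E derive_val.
have q0 : 0 < 1 + phi x ^+ 2 by rewrite ltr_wpDr// sqr_ge0.
rewrite ler_pdivrMl// [leRHS]mulrC.
have mux : `|mu m w r x| <= M by apply: hM; rewrite x0 (lt_trans xt te).
apply: (le_trans (ler_norm _)); rewrite normrM /C.
have : `|phi x ^+ 2 + 2 * mu m w r x * phi x + 1| <= (1 + M) * (1 + phi x ^+ 2).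
  have -> : phi x ^+ 2 + 2 * mu m w r x * phi x + 1 =
      (1 + phi x ^+ 2) + mu m w r x * (2 * phi x) by ring.
  rewrite [leRHS]mulrDl mul1r; apply: (le_trans (ler_normD _ _)).
  rewrite (gtr0_norm q0) lerD2l normrM ler_pM// ler_norml.
  have := sqr_ge0 (1 + phi x); have := sqr_ge0 (1 - phi x).
  by move=> ? ?; apply/andP; split; lra.
move=> /(ler_wpM2l (normr_ge0 r))/le_trans; apply.
by rewrite mulrA ler_wpM2r ?(ltW q0)// lerDl.
Qed.
End FirstHit.

(** * Locality of [a_star] and the iteration *)

Section Iteration.
Context {R : realType} (w r : R).
Implicit Types (f g m : R -> R) (t a c : R).

Lemma eqfun_itv f g t : {in `[0, +oo[, f =1 g} -> {in `[0, t], f =1 g}.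
Proof. by move=> fg x /andP[x0 _]; apply: fg; rewrite in_itv/= andbT. Qed.

Lemma a_star_ge0 f : (0 <= a_star f w r)%E.
Proof.
apply: le_ereal_inf_tmp => _ [t [J [phi [[sol _] Jt _]]] <-].
by rewrite lee_fin (ode_solution_ge0 sol Jt).
Qed.

Lemma a_star_le f t : reaches_one w r f t -> (a_star f w r <= t%:E)%E.
Proof. by move=> ft; apply: ereal_inf_lbound; exists t. Qed.

Lemma a_star_eq f g : {in `[0, +oo[, f =1 g} -> a_star f w r = a_star g w r.
Proof.
move=> fg; congr ereal_inf; congr image; apply/seteqP; split=> t.
  exact/reaches_one_eq/eqfun_itv.
by apply/reaches_one_eq => x xt; apply/esym; exact: eqfun_itv fg _ xt.
Qed.

(** Both functions reach 1 at the same times up to [c].  As [f] reaches it at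
    some time before [c], later times do not affect either infimum; with
    [a < c] this does not depend on the infimum being attained. *)
Lemma a_star_eq_itv f g a c : a_star f w r = a%:E -> a < c ->
  {in `[0, c], f =1 g} -> a_star g w r = a%:E.
Proof.
move=> fa ac fg.
have fgc t : t <= c -> {in `[0, t], f =1 g}.
  move=> tc x; rewrite in_itv/= => /andP[x0 xt].
  by rewrite fg// in_itv/= x0 (le_trans xt).
have fg_hit t : t <= c -> reaches_one w r f t -> reaches_one w r g t.
  by move=> tc; exact/reaches_one_eq/fgc.
have gf_hit t : t <= c -> reaches_one w r g t -> reaches_one w r f t.
  by move=> tc; apply/reaches_one_eq => x xt; apply/esym; exact: fgc tc _ xt.
apply/eqP; rewrite eq_le -{1}fa; apply/andP; split.
  have [_ [t0 ft0 <-]] :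
      exists2 y, [set t%:E | t in reaches_one w r f] y & (y < c%:E)%E.
    by apply: ereal_inf_lt; rewrite -/(a_star f w r) fa lte_fin.
  rewrite lte_fin => t0c; apply: le_ereal_inf_tmp => _ [t ft <-].
  have [tc|ct] := leP t c; first exact/a_star_le/fg_hit.
  apply: (le_trans (a_star_le (fg_hit _ (ltW t0c) ft0))).
  by rewrite lee_fin (ltW (lt_trans t0c ct)).
apply: le_ereal_inf_tmp => _ [t gt <-].
have [tc|ct] := leP t c; first by rewrite -fa; exact/a_star_le/gf_hit.
by rewrite lee_fin (ltW (lt_trans ac ct)).
Qed.

(** [U_op], like [frakS], sees its argument on the half-line only; this matters
    because [frakS m = m] holds there only, whereas the operators are iterated
    on functions on the whole line. *)
Lemma U_op_eq f g :
  {in `[0, +oo[, f =1 g} -> {in `[0, +oo[, U_op w r f =1 U_op w r g}.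
Proof.
move=> fg t t0; rewrite /U_op -(a_star_eq fg) !(fg t)//.
have := a_star_ge0 f; case: a_star => // a a0.
by rewrite (fg a) ?in_itv/= ?andbT.
Qed.

Lemma frakS_U_op_eq f g : {in `[0, +oo[, f =1 g} ->
  {in `[0, +oo[, frakS (U_op w r f) =1 frakS (U_op w r g)}.
Proof. by move=> fg t _; exact/frakS_eq/eqfun_itv/U_op_eq. Qed.

Lemma frakS_U_op_idem m : piecewise_C1 m 1 -> unit_bound m ->
  {in `[0, +oo[, frakS m =1 m} ->
  {in `[0, +oo[, frakS (U_op w r (frakS (U_op w r m))) =1 frakS (U_op w r m)}.
Proof.
move=> m_C1 hm m_inv.
case ma : (a_star m w r) => [a| |]; last 2 first.
- have Um : U_op w r m = m by apply/funext => t; rewrite /U_op ma.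
  by rewrite Um => t t0; rewrite (frakS_U_op_eq m_inv) ?Um.
- by have := a_star_ge0 m; rewrite ma.
have a_gt0 : 0 < a.
  have m0 : 0 < m 0 by rewrite hm.2.
  have [d d0 hd] := reaches_one_bounded_below w r ltr01 m_C1 m0.
  rewrite -lte_fin -ma (@lt_le_trans _ _ d%:E) ?lte_fin//.
  by apply: le_ereal_inf_tmp => _ [t /hd dt <-]; rewrite lee_fin.
set u := U_op w r m.
have a2 : a < 2 * a by rewrite mulr_natl mulr2n ltrDl.
have uE t : u t = if t <= 2 * a then m t
    else Num.min (m t) (expR ((w - r) * (t - 2 * a)) * m a ^+ 2).
  by rewrite /u /U_op ma.
have um : {in `[0, 2 * a], u =1 m} by move=> t /andP[_ ta]; rewrite uE ifT.
have hu : unit_bound u.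
  split=> [t t0|]; last first.
    by rewrite um ?hm.2// in_itv/= lexx ltW// (lt_trans a_gt0).
  rewrite uE; case: ifP => _; first exact: hm.1.
  by rewrite le_min hm.1// mulr_ge0 ?expR_ge0 ?sqr_ge0.
have Su_m : {in `[0, 2 * a], m =1 frakS u}.
  move=> t; rewrite in_itv/= => /andP[t0 ta].
  rewrite -[LHS]m_inv ?in_itv/= ?t0//; apply: frakS_eq => x.
  rewrite in_itv/= => /andP[x0 xt]; apply/esym/um.
  by rewrite in_itv/= x0 (le_trans xt).
(* This is where [a > 0] enters: the agreement goes beyond [a]. *)
have Su_a := a_star_eq_itv ma a2 Su_m.
have USu : {in `[0, +oo[, U_op w r (frakS u) =1 frakS u}.
  move=> t; rewrite in_itv/= andbT => t0; rewrite /U_op Su_a.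
  have [//|ta] := leP t (2 * a); apply/min_idPl.
  (* The bound is not active, since [frakS u <= u] and [u] satisfies it. *)
  rewrite -(Su_m a) ?in_itv/= ?(ltW a_gt0) ?(ltW a2)//.
  apply: (le_trans (frakS_le hu t0)).
  by rewrite uE (lt_geF ta) ge_min lexx orbT.
move=> t t0; transitivity (frakS (frakS u) t).
  exact/frakS_eq/eqfun_itv.
by apply: frakS_idem => //; move: t0; rewrite in_itv/= andbT.
Qed.

Lemma iter_frakS_U_op m k : piecewise_C1 m 1 -> unit_bound m ->
  {in `[0, +oo[, frakS m =1 m} ->
  {in `[0, +oo[, iter k.+1 (fun f => frakS (U_op w r f)) m =1
                 frakS (U_op w r m)}.
Proof.
move=> m_C1 hm m_inv; elim: k => [//|k IHk] t t0.
by rewrite iterS (frakS_U_op_eq IHk)// frakS_U_op_idem.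
Qed.

End Iteration.

Theorem proposition4p4 (R : realType) (H : completeNormedModType R[i])
    (inner : {dot H for (@Num.conj R[i])})
    (H_hilbert : forall x : H, `|x| ^+ 2 = inner x x)
    (S : R -> H -> H) (S_semigroup : is_C0_semigroup S)
    (m : R -> R)
    (m_pos : forall t : R, 0 <= t -> 0 < m t)
    (m_C1 : forall T : R, 0 <= T -> piecewise_C1 m T)
    (m0 : m 0 = 1)
    (S_le_m : forall t : R, 0 <= t -> (op_norm (S t) <= (m t)%:E)%E)
    (m_invariant : forall t : R, 0 <= t -> frakS m t = m t)
    (omega0 : R) (r_gt0 : 0 < resolvent_radius (generator S) omega0) :
  let SU := fun f : R -> R => frakS (U_omega (generator S) omega0 f) in
  (forall t : R, 0 <= t -> SU (SU m) t = SU m t) /\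
  (forall k : nat, (1 <= k)%N ->
     forall t : R, 0 <= t -> iter k SU m t = SU m t).
Proof.
move=> SU; have m_C1' := m_C1 1 ler01.
have hm : unit_bound m by split=> // t /m_pos/ltW.
have m_inv : {in `[0, +oo[, frakS m =1 m}.
  by move=> t; rewrite in_itv/= andbT; exact: m_invariant.
have SU_iter k t : 0 <= t -> iter k.+1 SU m t = SU m t.
  by move=> t0; apply: iter_frakS_U_op => //; rewrite in_itv/= andbT.
split=> [t t0|[//|k] _ t t0]; first exact: (SU_iter 1%N).
exact: SU_iter.
Qed.
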